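(* Let $E$ be a real Banach space, $H$ a real separable Hilbert space, $S=(S(t))_{t\ge 0}$ a $C_0$-semigroup on $E$, $B\in\mathscr{L}(H,E)$ a bounded linear operator and $W_H$ an $H$-cylindrical Brownian motion. Assume that $s\mapsto S(s)B$ is stochastically integrable with respect to $W_H$ on every interval $[0,T]$. Let $t>0$, let $a\in W^{1,\infty}(0,t)$ satisfy $a(0+)=0$ and $a(t-)=1$, let $\xi\in\mathscr{D}_t$, and put $$v_a^\xi(s):=a'(s)B^\dagger S(s)\xi,\qquad 0<s<t .$$ Then $$R_tv_a^\xi=S(t)\xi,\qquad\text{that is,}\qquad \int_0^tS(t-s)Bv_a^\xi(s)\,\mathrm{d}s=S(t)\xi .$$
   Context: $E_B:=\operatorname{Ran}(B)$, equipped with the Hilbert norm transported from $(\operatorname{Ker}B)^\perp\subseteq H$, i.e. $\|Bh\|_{E_B}=\|h\|_H$ for $h\in(\operatorname{Ker}B)^\perp$. Thus $B$ restricts to an isometry from $(\operatorname{Ker}B)^\perp$ onto $E_B$; its inverse is denoted $B^\dagger:E_B\to(\operatorname{Ker}B)^\perp\subseteq H$. For $t>0$ the space of admissible directions is $\mathscr{D}_t:=\{\xi\in E:\ S(\cdot)\xi\in L^2(0,t;E_B)\}$, i.e. $S(s)\xi\in E_B$ for almost all $s\in(0,t)$ and $\int_0^t\|S(s)\xi\|_{E_B}^2\,\mathrm{d}s<\infty$. For $\xi\in\mathscr{D}_t$ one has $v_a^\xi\in L^2(0,t;H)$. $R_t:L^2(0,t;H)\to E$ is the operator $R_tv:=\int_0^tS(t-s)Bv(s)\,\mathrm{d}s$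 (Bochner integral in $E$). $a(0+)$ and $a(t-)$ denote the one-sided limits at the end points of the (Lipschitz) continuous representative of $a$. Standing terminology: an $H$-cylindrical Brownian motion is a family $W_H(t):H\to L^2(\Omega)$, $t\ge0$, of bounded linear operators such that all vectors $(W_H(t_1)h_1,\dots,W_H(t_N)h_N)$ are centred Gaussian and $\mathbb{E}(W_H(s)g\,W_H(t)h)=(s\wedge t)(g|h)_H$. A bounded operator $R:\mathscr{H}\to E$ from a real separable Hilbert space $\mathscr{H}$ is $\gamma$-radonifying if for one (equivalently every) orthonormal basis $(h_n)$ of $\mathscr{H}$ and independent standard Gaussians $(\gamma_n)$ the series $\sum_n\gamma_nRh_n$ converges in $L^2(\Omega;E)$. A function $\Phi:\mathbb{R}_+\to\mathscr{L}(H,E)$ is stochastically integrable with respect to $W_H$ if $s\mapsto\langle\Phi(s)h,x^*\rangle$ is square integrable for all $h\in H$, $x^*\in E^*$, and there is a $\gamma$-radonifying operator $I_\Phi:L^2(\mathbb{R}_+;H)\to E$ with $\langle I_\Phi(\mathbf{1}_{[a,b)}\otimes h),x^*\rangle=\int_a^b\langle\Phi(s)h,x^*\rangle\,\mathrm{d}s$ for all $0\le a<b<\infty$, $h\in H$, $x^*\in E^*$; integrability on a finite interval is defined by extending by zero. *)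

(* Defs.v *)
From HB Require Import structures.
From mathcomp Require Import all_boot all_order all_algebra.
From mathcomp Require Import all_classical all_reals all_analysis.

Set Implicit Arguments.
Unset Strict Implicit.
Unset Printing Implicit Defensive.

Import Order.TTheory GRing.Theory Num.Theory.
Import numFieldNormedType.Exports.

Local Open Scope classical_set_scope.
Local Open Scope ring_scope.

Section Bochner.
Context d (T : measurableType d) (R : realType) (V : normedModType R).
Variables (mu : {measure set T -> \bar R}) (D : set T).
Implicit Types f s : T -> V.

Definition simple_fun s :=
  finite_set (range s) /\ forall y, measurable (s @^-1` [set y]).

Definition strongly_measurable f :=
  exists u_ : nat -> T -> V, (forall n, simple_fun (u_ n)) /\
    {ae mu, forall x, D x -> u_ n x @[n --> \oo] --> f x}.

Definition integrable_simple_fun s := simple_fun s /\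
  forall y, y != 0 -> (mu (D `&` s @^-1` [set y]) < +oo)%E.

(* The level set of y = 0 may have infinite measure; it contributes 0. *)
Definition simple_integral s : V :=
  \sum_(y \in range s) fine (mu (D `&` s @^-1` [set y])) *: y.

Definition bochner_approx f (u_ : nat -> T -> V) :=
  [/\ forall n, integrable_simple_fun (u_ n),
      {ae mu, forall x, D x -> u_ n x @[n --> \oo] --> f x} &
      (\int[mu]_(x in D) `|f x - u_ n x|%:E)%E @[n --> \oo] --> 0%E].

Definition bochner_integrable f := exists u_, bochner_approx f u_.

(* Only meaningful for bochner_integrable functions (0 is a default value);
   the limit does not depend on the approximating sequence. *)
Definition bochner_integral f : V :=
  xget 0 [set I | exists2 u_, bochner_approx f u_ &
                  simple_integral (u_ n) @[n --> \oo] --> I].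

Definition L2 f := strongly_measurable f /\
  (\int[mu]_(x in D) (`|f x| ^+ 2)%:E < +oo)%E.

End Bochner.

Definition separable_space (X : topologicalType) :=
  exists2 A : set X, countable A & dense A.

(* A Hilbert space is a complete normed module whose norm comes from dot. *)
Definition inner_product_norm (R : realType) (H : normedModType R)
    (dot : {dot H for (@idfun R)}) :=
  forall x : H, dot x x = `|x| ^+ 2.

Definition C0_semigroup (R : realType) (E : normedModType R)
    (S : R -> {linear E -> E}) :=
  [/\ forall s, 0 <= s -> continuous (S s),
      forall x, S 0 x = x,
      forall s u x, 0 <= s -> 0 <= u -> S (s + u) x = S s (S u x) &
      forall x, S s x @[s --> 0^'+] --> x].

Section Gaussian.
Context d (Omega : measurableType d) (R : realType) (P : probability Omega R).

(* normal_prob m s has standard deviation s, and is not a Dirac mass when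
   s = 0, so the degenerate law is treated apart. *)
Definition centred_gaussian (X : Omega -> R) :=
  measurable_fun setT X /\
  ({ae P, forall w, X w = 0} \/
   exists2 s : R, 0 < s &
     forall A, measurable A -> P (X @^-1` A) = normal_prob 0 s A).

Definition centred_gaussian_vector N (X : 'I_N -> Omega -> R) :=
  forall c : 'I_N -> R, centred_gaussian (fun w => \sum_(i < N) c i * X i w).

Definition standard_gaussian (X : Omega -> R) :=
  measurable_fun setT X /\
  forall A, measurable A -> P (X @^-1` A) = normal_prob 0 1 A.

Definition mutually_independent (X : nat -> Omega -> R) :=
  forall (J : seq nat) (A : nat -> set R), uniq J ->
    (forall j, measurable (A j)) ->
    P (\big[setI/setT]_(j <- J) (X j @^-1` A j)) =
    (\prod_(j <- J) P (X j @^-1` A j))%E.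

End Gaussian.

(* The law of W t as a map H -> L^2(Omega) only sees classes modulo P,
   so its linearity is almost sure. *)
Definition cylindrical_brownian_motion d (Omega : measurableType d)
    (R : realType) (P : probability Omega R) (H : normedModType R)
    (dot : {dot H for (@idfun R)}) (W : R -> H -> {RV P >-> R}) :=
  [/\ forall t, 0 <= t -> forall (c : R) (g h : H),
        {ae P, forall w, W t (c *: g + h) w = c * W t g w + W t h w},
      forall t, 0 <= t -> exists C : R, forall h,
        (\int[P]_w (W t h w ^+ 2)%:E <= (C * `|h| ^+ 2)%:E)%E,
      forall N (t : 'I_N -> R) (h : 'I_N -> H), (forall i, 0 <= t i) ->
        centred_gaussian_vector P (fun i => W (t i) (h i)) &
      forall (s t : R) (g h : H), 0 <= s -> 0 <= t ->
        expectation P (fun w => W s g w * W t h w) =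
        (Num.min s t * dot g h)%:E].

(* The Hilbert space is given by representatives: a set L of vectors of V,
   closed under linear combinations, with a positive semidefinite form ip;
   vectors of L at distance 0 are identified.  This is how the space of classes
   L^2(R_+; H) is handled below. *)
Section Radonifying.
Context (R : realType) (V : lmodType R).
Variables (L : set V) (ip : V -> V -> R).

(* The basis is indexed by a subset of nat, so as to cover finite dimension. *)
Definition orthonormal_basis (J : set nat) (h : nat -> V) :=
  [/\ forall n, J n -> L (h n),
      forall m n, J m -> J n -> ip (h m) (h n) = (m == n)%:R &
      forall f, L f ->
        (let r := f - \sum_(0 <= n < N | n \in J) ip f (h n) *: h n in ip r r)
          @[N --> \oo] --> 0].

Variable E : normedModType R.

(* Boundedness makes I constant on classes. *)
Definition bounded_operator (I : V -> E) :=
  (forall (c : R) f g, L f -> L g -> I (c *: f + g) = c *: I f + I g) /\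
  exists C : R, forall f, L f -> `|I f| ^+ 2 <= C * ip f f.

Definition gamma_radonifying (I : V -> E) :=
  bounded_operator I /\
  exists (J : set nat) (h : nat -> V) (d : measure_display)
    (Omega : measurableType d) (P : probability Omega R)
    (g : nat -> Omega -> R) (X : Omega -> E),
    [/\ orthonormal_basis J h,
        forall n, standard_gaussian P (g n),
        mutually_independent P g,
        L2 P setT X &
        (\int[P]_w (`|\sum_(0 <= n < N | n \in J) g n w *: I (h n) - X w|
                      ^+ 2)%:E)%E @[N --> \oo] --> 0%E].

End Radonifying.

Section Operators.
Context (R : realType) (H E : normedModType R) (dot : {dot H for (@idfun R)}).

Let mu := @lebesgue_measure R.

Definition ipL2 (f g : R -> H) : R := \int[mu]_(s in `[0, +oo[) dot (f s) (g s).

(* The notion depends on W_H only through H. *)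
Definition stochastically_integrable (Phi : R -> H -> E) :=
  (forall (h : H) (x' : {linear E -> R^o}), continuous x' ->
     L2 mu `[0, +oo[ (fun s => x' (Phi s h))) /\
  exists I : (R -> H) -> E,
    gamma_radonifying (L2 mu `[0, +oo[) ipL2 I /\
    forall (a b : R) (h : H) (x' : {linear E -> R^o}),
      0 <= a -> a < b -> continuous x' ->
      x' (I (fun s => \1_`[a, b[ s *: h)) =
      \int[mu]_(s in `[a, b]) x' (Phi s h).

Definition stochastically_integrable_on (T : R) (Phi : R -> H -> E) :=
  stochastically_integrable (fun s h => \1_`[0, T] s *: Phi s h).

Variables (B : {linear H -> E}) (S : R -> {linear E -> E}).

Definition perp_ker : set H := [set h | forall k, B k = 0 -> dot h k = 0].

Definition E_B : set E := range B.

(* B^\dagger, with default value 0 outside E_B *)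
Definition Bdag (x : E) : H := xget 0 [set h | perp_ker h /\ B h = x].

Definition normEB (x : E) : R := `|Bdag x|.

Definition admissible (t : R) : set E :=
  [set xi | {ae mu, forall s, s \in `]0, t[ -> E_B (S s xi)} /\
            (\int[mu]_(s in `]0%R, t[) (normEB (S s xi) ^+ 2)%:E < +oo)%E].

Definition R_integrand (t : R) (v : R -> H) (s : R) : E := S (t - s) (B (v s)).

Definition R_op (t : R) (v : R -> H) : E :=
  bochner_integral mu `]0, t[ (R_integrand t v).

Definition v_ctrl (a' : R -> R) (xi : E) (s : R) : H := a' s *: Bdag (S s xi).

End Operators.

Section Sobolev.
Context (R : realType) (t : R).

Let mu := @lebesgue_measure R.

Definition Linfty (f : R -> R) :=
  measurable_fun `]0, t[ f /\
  exists M : R, {ae mu, forall s, s \in `]0, t[ -> `|f s| <= M}.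

(* C_c^infty(0, t) *)
Definition test_function (phi : R -> R) :=
  (forall n x, derivable (phi^`(n))%classic x 1) /\
  exists2 K : set R, compact K /\ K `<=` `]0, t[ &
    forall x, ~ K x -> phi x = 0.

Definition weak_derivative (a a' : R -> R) :=
  forall phi, test_function phi ->
    \int[mu]_(s in `]0, t[) (a s * (phi^`())%classic s) =
    - \int[mu]_(s in `]0, t[) (a' s * phi s).

(* a \in W^{1,infty}(0, t) with weak derivative (represented by) a' *)
Definition W1infty (a a' : R -> R) :=
  [/\ Linfty a, Linfty a' & weak_derivative a a'].

(* a(0+) = l and a(t-) = r, the limits being those of the continuous
   representative of a *)
Definition boundary_values (a : R -> R) (l r : R) :=
  exists ac : R -> R,
    [/\ {in `]0, t[, continuous ac},
        {ae mu, forall s, s \in `]0, t[ -> a s = ac s},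
        ac s @[s --> 0^'+] --> l &
        ac s @[s --> t^'-] --> r].

End Sobolev.

(* Main.v *)
Require Import Defs.
From mathcomp Require Import all_boot all_order all_algebra finmap.
From mathcomp Require Import all_classical all_reals all_analysis.
From mathcomp Require Import measurable_realfun.
From mathcomp Require Import ring lra.
Set Implicit Arguments.
Unset Strict Implicit.
Unset Printing Implicit Defensive.
Import Order.TTheory GRing.Theory Num.Theory.
Import numFieldNormedType.Exports.
Local Open Scope classical_set_scope.
Local Open Scope ring_scope.

(** The integrand collapses. For almost every s in (0, t) the vector S(s) xi lies in
the range of B, hence B B^dagger S(s) xi = S(s) xi, and the semigroup law gives
S(t - s) B v(s) = a'(s) S(t - s) S(s) xi = a'(s) S(t) xi.
The integral is therefore (int_0^t a') S(t) xi, and int_0^t a' = a(t-) - a(0+) = 1.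

Three facts carry this computation.

- B B^dagger is the identity on the range of B ([Bdag_range]). This is the
  projection theorem: the element of least norm in the preimage of a point exists
  by the parallelogram identity and is orthogonal to the kernel of B.

- The Bochner integral of a scalar function times a fixed vector is the scalar
  integral times that vector ([bochner_integral_scale]). Scalar simple functions
  converging in L^1 supply one approximating sequence; [bochner_integral_eq] shows
  that every other approximating sequence yields the same limit.

- The integral of a weak derivative is the difference of the boundary values
  ([integral_weak_derivative]). The definition of a weak derivative only allows
  test functions in C_c^infty(0, t), so one tests against smooth plateaux that
  converge to 1 on (0, t). Their derivatives are smooth densities of mass 1 and
  -1 that concentrate at the two end points. The plateaux are differences of the
  transition functions [step], quotients built from exp(-1/x). *)

(** * Orthogonal projection and the pseudo-inverse of B *)

Section Projection.
Context (R : realType) (H : completeNormedModType R)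
  (dot : {dot H for (@idfun R)}).
Context (dot_norm : inner_product_norm dot).

Lemma dotC x y : dot x y = dot y x.
Proof. by rewrite (hermC dot) expr0 mul1r. Qed.

Lemma sqr_normD (x y : H) : `|x + y| ^+ 2 = `|x| ^+ 2 + 2 * dot x y + `|y| ^+ 2.
Proof.
rewrite -!dot_norm linearDl !linearDr /= (dotC y x).
ring.
Qed.

Lemma parallelogram (x y : H) :
  `|x - y| ^+ 2 = 2 * `|x| ^+ 2 + 2 * `|y| ^+ 2 - 4 * `|2^-1 *: (x + y)| ^+ 2.
Proof.
rewrite normrZ exprMn !sqr_normD normrN linearNr /= ger0_norm ?invr_ge0//.
by field.
Qed.

(** Minimality along the line through [x] in direction [k]: were [dot x k]
nonzero, a small step against its sign would shorten [x]. *)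
Lemma min_norm_perp (x k : H) :
  (forall c : R, `|x| ^+ 2 <= `|x + c *: k| ^+ 2) -> dot x k = 0.
Proof.
move=> min_x; apply/eqP/negP => /negP p_neq0.
set p := dot x k in p_neq0 *; pose q := `|k| ^+ 2.
have q_ge0 : 0 <= q by rewrite exprn_ge0.
(* The quadratic c |-> |x + c k|^2 is smallest at c = - p / q; dividing by
   q + 1 instead still decreases it and covers q = 0. *)
have := min_x (- p / (q + 1)).
rewrite sqr_normD linearZr_LR /= normrZ exprMn real_normK ?num_real//.
rewrite -/p -/q -addrA lerDl.
have -> : 2 * (- p / (q + 1) * p) + (- p / (q + 1)) ^+ 2 * q =
  - (p ^+ 2 * (q + 2) / (q + 1) ^+ 2) by field; lra.
have p2_gt0 : 0 < p ^+ 2 by rewrite exprn_even_gt0.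
have q1_gt0 : 0 < (q + 1) ^+ 2 by apply: exprn_gt0; lra.
by rewrite oppr_ge0 leNgt divr_gt0// mulr_gt0//; lra.
Qed.

(** A minimizing sequence is Cauchy by the parallelogram identity, because the
midpoints of its terms still lie in [A]; completeness gives the limit. *)
Lemma min_norm_exists (A : set H) : A !=set0 -> closed A ->
  (forall x y, A x -> A y -> A (2^-1 *: (x + y))) ->
  exists2 x, A x & forall y, A y -> `|x| ^+ 2 <= `|y| ^+ 2.
Proof.
move=> [x0 Ax0] clA midA.
pose N : set R := [set `|x| ^+ 2 | x in A].
have lbN : has_lbound N by exists 0 => _ [x _ <-]; rewrite exprn_ge0.
have infN : has_inf N by split; [exists (`|x0| ^+ 2), x0|].
pose m := inf N.
have m_le x : A x -> m <= `|x| ^+ 2 by move=> Ax; apply: ge_inf => //; exists x.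
have /choice[u uP] n : exists x, A x /\ `|x| ^+ 2 < m + n.+1%:R^-1.
  have [_ [x Ax <-] ltx] := @inf_adherent _ N n.+1%:R^-1 (ltac:(by [])) infN.
  by exists x.
have u_cauchy : cvg (u n @[n --> \oo]).
  apply: cauchy_cvg; apply: cauchy_exP => e e0.
  have [n _ nP] : \forall n \near \oo, 4 * n.+1%:R^-1 < e ^+ 2.
    near=> n; rewrite -ltr_pdivlMl// mulrC.
    by near: n; apply: (near_infty_natSinv_lt (PosNum _)); rewrite divr_gt0 ?exprn_gt0.
  exists (u n), n => // k /= nk; rewrite -ball_normE /=.
  rewrite -(@ltr_pXn2r _ 2) ?nnegrE ?(ltW e0)//; apply: le_lt_trans (nP n (leqnn n)).
  have [An un] := uP n; have [Ak uk] := uP k.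
  have := m_le _ (midA _ _ An Ak); rewrite parallelogram.
  have : (k.+1%:R^-1 : R) <= n.+1%:R^-1 by rewrite lef_pV2 ?posrE ?ler_nat.
  by move: (m) (n.+1%:R^-1) (k.+1%:R^-1) un uk => m1 p q; lra.
exists (lim (u n @[n --> \oo])).
  by apply: (closed_cvg A clA _ _ u_cauchy); apply: nearW => n; have [] := uP n.
move=> y Ay; apply: le_trans (m_le y Ay).
have u_lim : `|u n| ^+ 2 @[n --> \oo] --> `|lim (u n @[n --> \oo])| ^+ 2.
  by rewrite expr2; under eq_fun do rewrite expr2; apply: cvgM; apply: cvg_norm.
have u_m : `|u n| ^+ 2 @[n --> \oo] --> m.
  have m_lim : m + n.+1%:R^-1 @[n --> \oo] --> m.
    by rewrite -[X in _ --> X]addr0; apply: cvgD; [exact: cvg_cst|exact: cvg_harmonic].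
  apply: squeeze_cvgr (cvg_cst m) m_lim.
  by apply: nearW => n; have [An /ltW ->] := uP n; rewrite m_le.
by rewrite (cvg_unique _ u_lim u_m).
Unshelve. all: by end_near.
Qed.

End Projection.

(** [Bdag] is a genuine right inverse of [B] on its range: the preimage of [x] is
a nonempty closed affine subspace, and its element of least norm is
orthogonal to the kernel of [B], so that the choice made by [Bdag] is not the
default value. *)
Lemma Bdag_range (R : realType) (H : completeNormedModType R)
    (E : normedModType R) (dot : {dot H for (@idfun R)}) (B : {linear H -> E})
    (x : E) :
  inner_product_norm dot -> continuous B -> E_B B x ->
  B (Bdag dot B x) = x.
Proof.
move=> dot_norm cB [h0 _ Bh0].
have [|||h Bh hmin] := @min_norm_exists _ _ _ dot_norm (B @^-1` [set x]).
- by exists h0.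
- apply: closed_comp => [y _|]; first exact: cB.
  exact/accessible_closed_set1/hausdorff_accessible/norm_hausdorff.
- move=> y z /= yx zx; rewrite linearZ linearD /= yx zx -mulr2n.
  by rewrite -[x *+ 2]scaler_nat scalerA mulVf ?scale1r.
rewrite /Bdag; case: xgetP => [y _ []//|/(_ h)]; case; split=> //.
move=> k Bk; apply: (min_norm_perp dot_norm) => c; apply: hmin => /=.
by rewrite linearD linearZ /= Bk scaler0 addr0.
Qed.

(** * Integrals of simple functions *)

Section SimpleFunctions.
Context d (T : measurableType d) (R : realType).

Lemma simple_preimage (V : normedModType R) (w : T -> V) (A : set V) :
  simple_fun w -> measurable (w @^-1` A).
Proof.
move=> [wfin wm].
have -> : w @^-1` A = \bigcup_(p in range w `&` A) w @^-1` [set p].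
  by apply/seteqP; split=> [x Ax|x [p [_ Ap] /= ->]//]; exists (w x).
apply: fin_bigcup_measurable => [|p _]; last exact: wm.
exact: finite_setIl.
Qed.

Lemma simple_comp (V V' : normedModType R) (w : T -> V) (F : V -> V') :
  simple_fun w -> simple_fun (F \o w).
Proof.
move=> sw; split=> [|y]; last by rewrite comp_preimage; exact: simple_preimage.
by rewrite -(image_comp w F); apply: finite_image; case: sw.
Qed.

(** Two simple functions are read as one, so that their integrals can be computed
over a common partition, the fibres of the pair. *)
Lemma simple_pair (V V' : normedModType R) (u : T -> V) (v : T -> V') :
  simple_fun u -> simple_fun v -> simple_fun (fun x => (u x, v x) : (V * V')%type).
Proof.
move=> [ufin um] [vfin vm]; split=> [|[y z]].
  apply: (@sub_finite_set _ _ (range u `*` range v)); last exact: finite_setX.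
  by move=> _ [x _ <-]; split=> /=; exists x.
rewrite (_ : _ @^-1` _ = u @^-1` [set y] `&` v @^-1` [set z]).
  exact: measurableI.
by apply/seteqP; split=> x /=; [case=> -> ->|case=> -> ->].
Qed.

Context (mu : {measure set T -> \bar R}) (D : set T).
Hypotheses (mD : measurable D) (muD : (mu D < +oo)%E).

Definition fibre (V : normedModType R) (w : T -> V) p := D `&` w @^-1` [set p].

Lemma measurable_fibre (V : normedModType R) (w : T -> V) p :
  simple_fun w -> measurable (fibre w p).
Proof. by move=> sw; apply: measurableI => //; exact: simple_preimage. Qed.

Lemma fibre_fin_num (V : normedModType R) (w : T -> V) p :
  simple_fun w -> mu (fibre w p) \is a fin_num.
Proof.
move=> sw; rewrite ge0_fin_numE//; apply: le_lt_trans muD.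
by apply: le_measure; rewrite ?inE//; [exact: measurable_fibre|move=> x []].
Qed.

Lemma trivIset_fibre (V : normedModType R) (w : T -> V) (A : set V) :
  trivIset A (fibre w).
Proof. by move=> p q _ _ [x [[_ /= <-] [_ /= <-]]]. Qed.

Lemma simple_integrable (V : normedModType R) (w : T -> V) :
  simple_fun w -> integrable_simple_fun mu D w.
Proof.
by move=> sw; split=> // y _; rewrite -ge0_fin_numE//; exact: fibre_fin_num.
Qed.

(** Grouping the fibres of [w] by the value of [F] on them: the integral of a
simple function may be computed over any finer partition. *)
Lemma simple_integral_comp (V V' : normedModType R) (w : T -> V) (F : V -> V') :
  simple_fun w -> simple_integral mu D (F \o w) =
  \sum_(p \in range w) fine (mu (fibre w p)) *: F p.
Proof.
move=> sw; have sFw := simple_comp F sw.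
have [[wfin _] [Fwfin _]] := (sw, sFw).
rewrite /simple_integral !fsbig_finite//=.
have mu_fibre y : fine (mu (fibre (F \o w) y)) =
    \sum_(p <- fset_set (range w)) if F p == y then fine (mu (fibre w p)) else 0.
  have -> : fibre (F \o w) y = \bigcup_(p in range w `&` F @^-1` [set y]) fibre w p.
    apply/seteqP; split=> [x [Dx /= Fwx]|x [p [_ Fp] [Dx /= wx]]].
      by exists (w x).
    by split=> //=; rewrite wx.
  rewrite measure_fin_bigcup//; last 3 first.
  - exact: finite_setIl.
  - exact: trivIset_fibre.
  - by move=> p _; exact: measurable_fibre.
  rewrite fsbig_mkcondr fsbig_finite//= -sum_fine//.
    apply: eq_bigr => p _; case: ifPn => [/set_mem /= ->|]; first by rewrite eqxx.
    by case: eqP => // Fp /negP[]; rewrite inE.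
  by move=> p _; case: ifP => // _; exact: fibre_fin_num.
under eq_bigr => y _.
  rewrite -/(fibre _ _) mu_fibre scaler_suml.
  over.
rewrite exchange_big /=; apply: eq_big_seq => p.
rewrite in_fset_set// inE => -[x _ wx].
rewrite (bigD1_seq (F p)) ?fset_uniq//=; last first.
  by rewrite in_fset_set// inE; exists x => //=; rewrite wx.
rewrite eqxx big1 ?addr0// => y /negPf; rewrite eq_sym => ->.
by rewrite scale0r.
Qed.

Lemma measurable_simple (V : normedModType R) (w : T -> V) (F : V -> R) :
  simple_fun w -> measurable_fun D (F \o w).
Proof.
move=> sw; apply/measurable_funTS => _ /= B _.
by rewrite setTI; apply: (simple_preimage (F @^-1` B)).
Qed.

(** The Lebesgue counterpart of [simple_integral_comp] for scalar functions of
[w]; together they turn norm estimates on simple integrals into termwise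
triangle inequalities. *)
Lemma integral_simple_comp (V : normedModType R) (w : T -> V) (F : V -> R) :
  simple_fun w -> (\int[mu]_(x in D) (F (w x))%:E =
  (\sum_(p \in range w) fine (mu (fibre w p)) * F p)%:E)%E.
Proof.
move=> sw; have [wfin _] := sw.
have DE : D = \big[setU/set0]_(p <- fset_set (range w)) fibre w p.
  rewrite -bigcup_fset; apply/seteqP; split=> [x Dx|x [p _ []//]].
  by exists (w x) => //=; rewrite in_fset_set// inE; exists x.
rewrite fsbig_finite//= -sumEFin {1}DE integral_bigsetU_EFin//; last 3 first.
- by move=> p; exact: measurable_fibre.
- exact: trivIset_fibre.
- by rewrite -DE; apply/measurable_EFinP; exact: measurable_simple sw.
apply: eq_bigr => p _.
transitivity (\int[mu]_(x in fibre w p) (F p)%:E)%E.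
  by apply: eq_integral => x; rewrite inE => -[_ /= ->].
rewrite integral_cst; last exact: measurable_fibre.
by rewrite EFinM fineK ?fibre_fin_num// muleC.
Qed.

Lemma norm_simple_integralB (V : normedModType R) (u v : T -> V) :
  simple_fun u -> simple_fun v ->
  (`|simple_integral mu D u - simple_integral mu D v|%:E <=
   \int[mu]_(x in D) `|u x - v x|%:E)%E.
Proof.
move=> su sv; have suv := simple_pair su sv; have [uvfin _] := suv.
have := integral_simple_comp (fun p => `|p.1 - p.2|) suv => /= ->.
rewrite (simple_integral_comp fst suv) (simple_integral_comp snd suv).
rewrite lee_fin !fsbig_finite//= -sumrB; apply: le_trans (ler_norm_sum _ _ _) _.
apply: ler_sum => p _; rewrite -scalerBr normrZ ger0_norm//.
Qed.

End SimpleFunctions.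

(** * The Bochner integral *)

Section LowerIntegral.
Context d (T : measurableType d) (R : realType).
Context (mu : {measure set T -> \bar R}) (D : set T) (mD : measurable D).
Local Open Scope ereal_scope.
Import HBNNSimple.

(** The Lebesgue integral of a nonnegative function is a supremum over the simple
functions below it, so it is monotone even when only the smaller function is
measurable. The functions [`|f x - u_ n x|] in the definition of the
Bochner integral need not be measurable: Lebesgue measure is taken on Borel
sets, and [f] is controlled only almost everywhere. *)
Lemma ae_le_integral_above (k h : T -> \bar R) : measurable_fun D k ->
  (forall x, D x -> 0 <= k x) -> (forall x, D x -> 0 <= h x) ->
  {ae mu, forall x, D x -> k x <= h x} ->
  \int[mu]_(x in D) k x <= \int[mu]_(x in D) h x.
Proof.
move=> mk k0 h0 [N [mN N0 subN]].
rewrite (ge0_negligible_integral mN mD mk k0 N0).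
rewrite ge0_integralE => [|x [Dx _]]; last exact: k0.
rewrite ge0_integralE//; apply: le_ereal_sup => _ [phi phik <-]; exists phi => //.
move=> x /=; apply: le_trans (phik x) _; rewrite /patch.
case: ifPn => [|_]; last by case: ifPn => //; rewrite inE => /h0.
rewrite inE => -[Dx Nx]; rewrite mem_set//.
by apply: contrapT => khx; apply/Nx/subN => /= /(_ Dx).
Qed.

(** Dual to [ae_le_integral_above]: here only the larger function is measurable. *)
Lemma ae_le_integral_below (h k : T -> \bar R) : measurable_fun D k ->
  (forall x, D x -> 0 <= h x) -> (forall x, D x -> 0 <= k x) ->
  {ae mu, forall x, D x -> h x <= k x} ->
  \int[mu]_(x in D) h x <= \int[mu]_(x in D) k x.
Proof.
move=> mk h0 k0 hk; rewrite ge0_integralE//; apply: ge_ereal_sup => _ [phi phih <-].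
have -> : sintegral mu phi = \int[mu]_x (phi x)%:E.
  by rewrite integral_nnsfun// patch_setT.
rewrite [leRHS]integral_mkcond; apply: ae_ge0_le_integral => //.
- by move=> x0 _; rewrite lee_fin.
- exact/measurable_EFinP.
- by move=> x _; rewrite /patch; case: ifPn => //; rewrite inE => /k0.
- exact/(measurable_restrictT _ mD).
apply: filterS hk => x hkx _; apply: le_trans (phih x) _; rewrite /patch.
by case: ifPn => //; rewrite inE => /hkx.
Qed.

End LowerIntegral.

Section BochnerIntegral.
Context d (T : measurableType d) (R : realType) (V : normedModType R).
Context (mu : {measure set T -> \bar R}) (D : set T).
Hypotheses (mD : measurable D) (muD : (mu D < +oo)%E).

(** An approximation [v_] with measurable error bounds [e_] determines the Bochner
integral. Any other approximation [u_] leads to the same limit, because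
[|int u_n - int v_n| <= int |u_n - v_n|], and the measurable function
[max (|u_n - v_n| - e_n) 0] lies almost everywhere below [|f - u_n|]. Passing
through this function avoids adding integrals of functions that may fail to
be measurable. *)
Lemma bochner_integral_eq (f : T -> V) (v_ : nat -> T -> V)
    (e_ : nat -> T -> R) (I : V) :
  (forall n, simple_fun (v_ n)) ->
  {ae mu, forall x, D x -> v_ n x @[n --> \oo] --> f x} ->
  (forall n, measurable_fun D (e_ n)) -> (forall n x, 0 <= e_ n x) ->
  (forall n, {ae mu, forall x, D x -> `|f x - v_ n x| <= e_ n x}) ->
  (\int[mu]_(x in D) (e_ n x)%:E)%E @[n --> \oo] --> 0%E ->
  simple_integral mu D (v_ n) @[n --> \oo] --> I ->
  bochner_integrable mu D f /\ bochner_integral mu D f = I.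
Proof.
move=> sv vf me e0 fve ecvg vI.
have mEe n : measurable_fun D (EFin \o e_ n) by exact/measurable_EFinP.
have fv : bochner_approx mu D f v_.
  split=> //; first by move=> n; exact: simple_integrable.
  apply: squeeze_cvge (cvg_cst 0%E) ecvg; apply: nearW => n.
  rewrite integral_ge0//=; apply: ae_le_integral_below => //.
  - exact: mEe.
  - by move=> x _; rewrite lee_fin.
  - by apply: filterS (fve n) => x + Dx; rewrite lee_fin; exact.
split; first by exists v_.
apply: xget_unique; first by exists v_.
move=> J [u_ [iu uf ucvg] uJ].
have su n : simple_fun (u_ n) by have [] := iu n.
have bnd n : (`|simple_integral mu D (u_ n) - simple_integral mu D (v_ n)|%:E <=
    \int[mu]_(x in D) `|f x - u_ n x|%:E + \int[mu]_(x in D) (e_ n x)%:E)%E.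
  pose k x := `|u_ n x - v_ n x|.
  have mk : measurable_fun D k.
    exact: (measurable_simple (fun p => `|p.1 - p.2|) (simple_pair (su n) (sv n))).
  pose k' x := Num.max (k x - e_ n x) 0.
  have mk' : measurable_fun D (EFin \o k').
    by apply/measurable_EFinP/measurable_maxr => //; exact: measurable_funB.
  apply: le_trans (norm_simple_integralB mD muD (su n) (sv n)) _.
  apply: (@le_trans _ _ (\int[mu]_(x in D) ((k' x)%:E + (e_ n x)%:E))%E).
    apply: ge0_le_integral => //=.
    - exact/measurable_EFinP.
    - exact: (emeasurable_funD mk' (mEe n)).
    - by move=> x _; rewrite -EFinD lee_fin -lerBlDr le_max lexx.
  have k'0 x : D x -> (0 <= (k' x)%:E)%E by rewrite lee_fin le_max lexx orbT.
  have Ee0 x : D x -> (0 <= (e_ n x)%:E)%E by rewrite lee_fin.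
  rewrite (ge0_integralD mu mD k'0 mk' Ee0 (mEe n)) leeD2r//.
  apply: ae_le_integral_above => //=.
  apply: filterS (fve n) => x fvx Dx; rewrite lee_fin ge_max normr_ge0 andbT.
  rewrite lerBlDr (distrC (f x)) (le_trans (ler_distD (f x) _ _))// lerD//.
  exact: fvx.
have uv0 : simple_integral mu D (u_ n) - simple_integral mu D (v_ n) @[n --> \oo]
    --> (0 : V).
  apply/norm_cvg0P.
  have : (`|simple_integral mu D (u_ n) - simple_integral mu D (v_ n)|%:E)%E
      @[n --> \oo] --> 0%E.
    have sum0 := cvgeD (isT : (0 : \bar R) +? 0)%E ucvg ecvg.
    rewrite adde0 in sum0; apply: squeeze_cvge (cvg_cst 0%E) (sum0 _).
    apply: nearW => n.
    by rewrite lee_fin normr_ge0 bnd.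
  by move/fine_cvg.
have JI : J - I = 0 by apply: cvg_unique (cvgB uJ vI) uv0; exact: norm_hausdorff.
by apply/eqP; rewrite -subr_eq0 JI.
Qed.

Import HBSimple.

Lemma sfun_simple (q : {sfun T >-> R}) : simple_fun (q : T -> R^o).
Proof. by split=> [|y]; [exact: fimfunP|exact: measurable_funPTI]. Qed.

(** Scalar simple functions approximating [g] in L^1, multiplied by [c], are an
admissible approximation of [f], with error [`|g - q_n| * `|c|]. *)
Theorem bochner_integral_scale (g : T -> R) (c : V) (f : T -> V) :
  mu.-integrable D (EFin \o g) ->
  {ae mu, forall x, D x -> f x = g x *: c} ->
  bochner_integrable mu D f /\
  bochner_integral mu D f = (\int[mu]_(x in D) g x) *: c.
Proof.
move=> ig fg; have [q [iq qg qL1]] := approximation_sfun_integrable mD ig.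
have mg : measurable_fun D g by apply/measurable_EFinP; exact: measurable_int ig.
have mq n : measurable_fun D (q n) by exact: measurable_funTS.
have igq n : mu.-integrable D (EFin \o (g \- q n)).
  by rewrite (_ : _ \o _ = (EFin \o g) \- (EFin \o q n))%E//; exact: integrableB.
have gq0 : \int[mu]_(x in D) `|g x - q n x| @[n --> \oo] --> 0.
  exact: fine_cvg qL1.
apply: (@bochner_integral_eq _ (fun n x => q n x *: c)
    (fun n x => `|g x - q n x| * `|c|)).
- by move=> n; exact: (simple_comp (fun r : R^o => r *: c) (sfun_simple (q n))).
- apply: filterS fg => x fx Dx; rewrite fx//; apply: cvgZr_tmp.
  by have /fine_cvg := qg x Dx.
- by move=> n; apply: measurable_funM => //; apply: measurableT_comp => //;
    exact: measurable_funB.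
- by move=> n x; rewrite mulr_ge0.
- move=> n; apply: filterS fg => x fx Dx.
  by rewrite fx// -scalerBl normrZ.
- rewrite [X in X @ _ --> _](_ : _ =
      (fun n => \int[mu]_(x in D) `|(g x)%:E - (q n x)%:E| * `|c|%:E)%E).
    rewrite -[X in _ --> X](mul0e `|c|%:E); apply: cvgeZr => //.
  apply/funext => n; rewrite -ge0_integralZr//.
    by apply/measurable_EFinP; apply: measurableT_comp => //; exact: measurable_funB.
have SI n : simple_integral mu D (fun x => q n x *: c) = (\int[mu]_(x in D) q n x) *: c.
  rewrite (simple_integral_comp mD muD (fun r : R^o => r *: c) (sfun_simple (q n))).
  rewrite /Rintegral (integral_simple_comp mD muD id (sfun_simple (q n)))/=.
  have [qfin _] := sfun_simple (q n).
  rewrite !fsbig_finite//= scaler_suml; apply: eq_bigr => r _.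
  by rewrite scalerA.
under eq_fun do rewrite SI.
apply: cvgZr_tmp; apply/subr_cvg0.
apply/norm_cvg0P; apply: squeeze_cvgr (cvg_cst 0) gq0; apply: nearW => n.
by rewrite normr_ge0/= distrC -(RintegralB mD ig (iq n))
  (le_normr_Rintegral mD (igq n)).
Qed.

End BochnerIntegral.

(** * Smooth functions and exp(-1/x) *)

Section Smooth.
Context (R : realType).
Implicit Types (f g : R -> R) (x : R).

(** Recursion on the derivative lets the closure properties below go by induction
on [n], from the rules for first derivatives. *)
Fixpoint derivable_upto n f : Prop :=
  if n is m.+1 then (forall x, derivable f x 1) /\ derivable_upto m (f^`())%classic
  else True.

Lemma derivable_upto_is_derive n f f' :
  (forall x : R, is_derive x (1 : R) f (f' x)) -> derivable_upto n f' ->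
  derivable_upto n.+1 f.
Proof.
move=> ff' sf'; split=> [x|]; first exact: (ex_derive (is_derive := ff' x)).
rewrite (_ : (f^`())%classic = f')//; apply/funext => x; rewrite derive1E.
exact: derive_val.
Qed.

Lemma derivable_upto_derive n f x :
  derivable_upto n.+1 f -> derivable (f^`(n))%classic x 1.
Proof.
elim: n f => [|n IHn] f [df sf]; first exact: df.
by rewrite derive1Sn; exact: IHn.
Qed.

Lemma derivable_uptoW n f : derivable_upto n.+1 f -> derivable_upto n f.
Proof. by elim: n f => // n IHn f [df sf]; split=> //; exact: IHn. Qed.

Lemma derivable_upto1 n f x :
  derivable_upto n.+1 f -> is_derive x (1 : R) f ((f^`())%classic x).
Proof. by move=> [df _]; rewrite derive1E; exact/derivableP. Qed.

Lemma derivable_upto_cst n c : derivable_upto n (cst c).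
Proof.
elim: n c => // n IHn c; exact: (@derivable_upto_is_derive _ _ (cst 0)).
Qed.

Lemma derivable_uptoD n f g : derivable_upto n f -> derivable_upto n g ->
  derivable_upto n (f + g).
Proof.
elim: n f g => // n IHn f g sf sg.
apply: (@derivable_upto_is_derive _ _ ((f^`())%classic + (g^`())%classic)).
  by move=> x; exact: is_deriveD (derivable_upto1 x sf) (derivable_upto1 x sg).
by have [[_ ?] [_ ?]] := (sf, sg); exact: IHn.
Qed.

Lemma derivable_uptoM n f g : derivable_upto n f -> derivable_upto n g ->
  derivable_upto n (f * g).
Proof.
elim: n f g => // n IHn f g sf sg.
apply: (@derivable_upto_is_derive _ _ (f * (g^`())%classic + g * (f^`())%classic)).
  by move=> x; exact: is_deriveM (derivable_upto1 x sf) (derivable_upto1 x sg).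
have [[_ ?] [_ ?]] := (sf, sg).
by apply: derivable_uptoD; apply: IHn => //; exact: derivable_uptoW.
Qed.

Lemma derivable_uptoV n f : (forall x, f x != 0) -> derivable_upto n f ->
  derivable_upto n (fun x => (f x)^-1).
Proof.
move=> f0; elim: n => // n IHn sf; have sV := IHn (derivable_uptoW sf).
apply: (@derivable_upto_is_derive _ _
  (cst (-1) * ((fun x => (f x)^-1) * (fun x => (f x)^-1)) * (f^`())%classic)).
  move=> x; apply: is_derive_eq (is_deriveV (f0 x) (derivable_upto1 x sf)) _.
  by rewrite /GRing.scale /= -[cst _ * _ * _]/(fun _ => _ * _ * _) /=
    mulN1r -exprVn expr2.
by do !apply: derivable_uptoM => //; [exact: derivable_upto_cst|case: sf].
Qed.

Lemma derivable_upto_affine n f a b : derivable_upto n f ->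
  derivable_upto n (fun x => f (a * x + b)).
Proof.
elim: n f => // n IHn f sf.
apply: (@derivable_upto_is_derive _ _ ((fun x => (f^`())%classic (a * x + b)) * cst a)).
  move=> x; apply: (@is_derive1_comp _ f (fun x => a * x + b)).
    exact: (derivable_upto1 _ sf).
  by apply: is_derive_eq; rewrite /GRing.scale/= addr0 mulr1.
apply: derivable_uptoM; last exact: derivable_upto_cst.
by apply: IHn; case: sf.
Qed.

Lemma is_derive0_sqr_bound f C : f 0 = 0 -> (forall x, `|f x| <= C * x ^+ 2) ->
  is_derive (0 : R) (1 : R) f 0.
Proof.
move=> f0 fC.
have lim0 : h^-1 *: ((f \o shift 0) (h *: 1) - f 0) @[h --> 0^'] --> (0 : R).
  apply/norm_cvg0P.
  have C0 : C * `|h| @[h --> (0 : R)^'] --> 0.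
    rewrite -[X in _ --> X](mulr0 C) -[X in C * X](@normr0 _ R).
    by apply: cvgZl_tmp; apply: cvg_norm; exact: nbhs_dnbhs.
  apply: squeeze_cvgr (cvg_cst 0) C0; near=> h.
  have h0 : h != 0 by near: h; exact: nbhs_dnbhs_neq.
  rewrite normr_ge0/= f0 subr0 addr0 /GRing.scale/= mulr1 normrM normfV.
  rewrite ler_pdivrMl ?normr_gt0//; apply: le_trans (fC h) _.
  by rewrite [leRHS]mulrCA -expr2 real_normK ?num_real.
apply: DeriveDef; first by apply: cvgP lim0.
exact: cvg_lim lim0.
Unshelve. all: by end_near.
Qed.

(** The classical flat function is the case [k = 0]. The other powers are included
because the family is closed under differentiation up to linear
combinations (see [is_derive_flat_exp]), which makes smoothness an induction. *)
Definition flat_exp k x : R := if 0 < x then x ^- k * expR (- x^-1) else 0.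

Lemma flat_exp_ge0 k x : 0 <= flat_exp k x.
Proof.
by rewrite /flat_exp; case: ifPn => // /ltW x0;
  rewrite mulr_ge0 ?invr_ge0 ?exprn_ge0 ?expR_ge0.
Qed.

Lemma flat_exp_gt0 k x : 0 < x -> 0 < flat_exp k x.
Proof.
by move=> x0; rewrite /flat_exp x0 mulr_gt0 ?invr_gt0 ?exprn_gt0 ?expR_gt0.
Qed.

Lemma flat_exp_eq0 k x : x <= 0 -> flat_exp k x = 0.
Proof. by rewrite /flat_exp leNgt => /negPf ->. Qed.

(** One term of the exponential series, (1/x)^(k+2) / (k+2)! <= exp(1/x), beats
the factor x^-k by two powers; a quadratic bound gives derivative 0
at 0. *)
Lemma flat_exp_sqr_bound k x : `|flat_exp k x| <= (k.+2)`!%:R * x ^+ 2.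
Proof.
rewrite ger0_norm ?flat_exp_ge0//; have [x0|x0] := leP x 0.
  by rewrite flat_exp_eq0// mulr_ge0 ?sqr_ge0.
rewrite /flat_exp x0 expRN.
have /(le_trans _) : 1 + x^-1 ^+ k.+2 / (k.+2)`!%:R <= expR x^-1.
  by apply: expR_ge1Dxn; rewrite invr_ge0 ltW.
move=> /(_ (x^-1 ^+ k.+2 / (k.+2)`!%:R)); rewrite lerDr => /(_ ler01).
have fact_gt0R : 0 < (k.+2)`!%:R :> R by rewrite ltr0n fact_gt0.
rewrite ler_pdivrMr// => le_exp.
rewrite ler_pdivrMr ?expR_gt0//.
have -> : x ^- k = x ^+ 2 * x^-1 ^+ (2 + k).
  by rewrite exprD mulrA -exprMn divff ?gt_eqF// expr1n mul1r exprVn.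
rewrite [leRHS](_ : _ = x ^+ 2 * (expR x^-1 * (k.+2)`!%:R)).
  exact: ler_wpM2l (sqr_ge0 x) _ _ le_exp.
by move: (expR _) (_%:R) => e c; ring.
Qed.

Lemma is_derive_flat_exp k (x : R) :
  is_derive x (1 : R) (flat_exp k) (- k%:R * flat_exp k.+1 x + flat_exp k.+2 x).
Proof.
have [x0|x0|->] := ltgtP x 0.
- rewrite !flat_exp_eq0 ?ltW// mulr0 addr0.
  apply: (near_eq_is_derive _ (is_derive_cst (0 : R) x 1)).
  by near=> y; rewrite flat_exp_eq0// ltW//; near: y; exact: lt_nbhsl.
- have dV : is_derive x (1 : R) (fun y : R => y^-1) (- x^-1 ^+ 2).
    apply: is_derive_eq (is_deriveV (lt0r_neq0 x0) (is_derive_id x 1)) _.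
    by rewrite /GRing.scale/= mulr1 exprVn.
  have dN : is_derive x (1 : R) (fun y : R => - y^-1) (x^-1 ^+ 2).
    exact: is_derive_eq (is_deriveN dV) (opprK _).
  have dE := @is_derive1_comp _ expR _ x _ _ (is_derive_expR (- x^-1)) dN.
  have dM := is_deriveM (is_deriveX k dV) dE.
  apply: (near_eq_is_derive _ (is_derive_eq dM _)).
    near=> y; have y0 : 0 < y by near: y; exact: lt_nbhsr.
    by rewrite /flat_exp y0 -exprVn !fctE.
  rewrite /flat_exp x0 !fctE /GRing.scale /= -!exprVn.
  move: (expR (- x^-1)) (x^-1) => e y; case: k {dM} => [|k]; rewrite /= ?exprS; ring.
- rewrite !flat_exp_eq0// mulr0 addr0.
  by apply: is_derive0_sqr_bound (flat_exp_sqr_bound k); rewrite flat_exp_eq0.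
Unshelve. all: by end_near.
Qed.

Lemma derivable_upto_flat_exp n k : derivable_upto n (flat_exp k).
Proof.
elim: n k => // n IHn k.
apply: (@derivable_upto_is_derive _ _ (cst (- k%:R) * flat_exp k.+1 + flat_exp k.+2)).
  exact: is_derive_flat_exp.
apply: derivable_uptoD => //; apply: derivable_uptoM => //.
exact: derivable_upto_cst.
Qed.

End Smooth.

(** * Smooth transition functions *)

Section Step.
Context (R : realType) (l r : R) (lr : l < r).

(** A smooth transition function: for [l < r] the quotient is smooth since the two
summands of the denominator never vanish together. *)
Definition step (x : R) : R :=
  flat_exp 0 (x - l) / (flat_exp 0 (x - l) + flat_exp 0 (r - x)).

(** The derivative of [step] (see [derive1_step]), in a form that shows its sign
and support. *)
Definition dstep (x : R) : R :=
  (flat_exp 2 (x - l) * flat_exp 0 (r - x) + flat_exp 0 (x - l) * flat_exp 2 (r - x)) /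
  (flat_exp 0 (x - l) + flat_exp 0 (r - x)) ^+ 2.

Lemma step_den_gt0 x : 0 < flat_exp 0 (x - l) + flat_exp 0 (r - x).
Proof.
have [lx|xl] := ltP l x.
  by rewrite ltr_pwDl ?flat_exp_ge0// flat_exp_gt0// subr_gt0.
by rewrite ltr_wpDl ?flat_exp_ge0// flat_exp_gt0// subr_gt0 (le_lt_trans xl).
Qed.

Lemma step_le x : x <= l -> step x = 0.
Proof. by move=> xl; rewrite /step flat_exp_eq0 ?mul0r// subr_le0. Qed.

Lemma step_ge x : r <= x -> step x = 1.
Proof.
move=> rx; rewrite /step [flat_exp _ (r - x)]flat_exp_eq0 ?subr_le0// addr0 divff//.
by rewrite gt_eqF// flat_exp_gt0// subr_gt0 (lt_le_trans lr).
Qed.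

Lemma step_ge0 x : 0 <= step x.
Proof. by rewrite divr_ge0 ?flat_exp_ge0// ltW// step_den_gt0. Qed.

Lemma step_le1 x : step x <= 1.
Proof. by rewrite ler_pdivrMr ?step_den_gt0// mul1r lerDl flat_exp_ge0. Qed.

Lemma dstep_ge0 x : 0 <= dstep x.
Proof. by rewrite divr_ge0 ?sqr_ge0// addr_ge0// mulr_ge0// flat_exp_ge0. Qed.

Lemma dstep_out x : x <= l \/ r <= x -> dstep x = 0.
Proof.
case=> hx; rewrite /dstep.
  by rewrite !(flat_exp_eq0 _ (_ : x - l <= 0)) ?subr_le0// !mul0r addr0 mul0r.
by rewrite !(flat_exp_eq0 _ (_ : r - x <= 0)) ?subr_le0// !mulr0 addr0 mul0r.
Qed.

Lemma is_derive_step (x : R) : is_derive x (1 : R) step (dstep x).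
Proof.
have dl : is_derive x (1 : R) (fun y : R => flat_exp 0 (y - l)) (flat_exp 2 (x - l)).
  have dB : is_derive x (1 : R) (fun y : R => y - l) 1.
    by apply: is_derive_eq; rewrite oppr0 addr0.
  have dF := is_derive_flat_exp 0 (x - l).
  apply: is_derive_eq (@is_derive1_comp _ (flat_exp 0) _ x _ _ dF dB) _.
  by rewrite oppr0 mul0r add0r mulr1.
have dr : is_derive x (1 : R) (fun y : R => flat_exp 0 (r - y)) (- flat_exp 2 (r - x)).
  have dB : is_derive x (1 : R) (fun y : R => r - y) (-1).
    by apply: is_derive_eq; rewrite add0r mul1r.
  have dF := is_derive_flat_exp 0 (r - x).
  apply: is_derive_eq (@is_derive1_comp _ (flat_exp 0) _ x _ _ dF dB) _.
  by rewrite oppr0 mul0r add0r mulrN1.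
have den0 := lt0r_neq0 (step_den_gt0 x).
have dV := @is_deriveV _ (fun y => flat_exp 0 (y - l) + flat_exp 0 (r - y)) x _ 1
  den0 (is_deriveD dl dr).
apply: is_derive_eq (is_deriveM dl dV) _; rewrite /dstep /GRing.scale/=.
by field.
Qed.

Lemma derivable_upto_step n : derivable_upto n step.
Proof.
have sl : derivable_upto n (fun x : R => flat_exp 0 (x - l)).
  rewrite [f in derivable_upto n f](_ : _ = (fun x : R => flat_exp 0 (1 * x - l))).
    exact: (derivable_upto_affine _ _ (derivable_upto_flat_exp _ n 0)).
  by apply/funext => x; rewrite mul1r.
have sr : derivable_upto n (fun x : R => flat_exp 0 (r - x)).
  rewrite [f in derivable_upto n f](_ : _ = (fun x : R => flat_exp 0 (-1 * x + r))).
    exact: (derivable_upto_affine _ _ (derivable_upto_flat_exp _ n 0)).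
  by apply/funext => x; rewrite mulN1r addrC.
apply: (derivable_uptoM sl); apply: derivable_uptoV;
  last exact: (derivable_uptoD sl sr).
by move=> x; rewrite lt0r_neq0// step_den_gt0.
Qed.

Lemma derive1_step : (step^`())%classic = dstep.
Proof.
by apply/funext => x; rewrite derive1E;
  exact: (derive_val (is_derive := is_derive_step x)).
Qed.

Lemma continuous_dstep : continuous dstep.
Proof.
move=> x; apply: differentiable_continuous; apply/derivable1_diffP.
by rewrite -derive1_step; have [_ []] := derivable_upto_step 2.
Qed.

Lemma continuous_step : continuous step.
Proof.
move=> x; apply: differentiable_continuous; apply/derivable1_diffP.
by have [] := derivable_upto_step 1.
Qed.

Local Notation mu := (@lebesgue_measure R).

Lemma measurable_dstep (A : set R) : measurable_fun A dstep.
Proof.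
apply: measurable_funTS.
by apply: continuous_measurable_fun; exact: continuous_dstep.
Qed.

Lemma measurable_step (A : set R) : measurable_fun A step.
Proof.
apply: measurable_funTS.
by apply: continuous_measurable_fun; exact: continuous_step.
Qed.

(** With [dstep_ge0] and [dstep_out] this makes [dstep] a smooth probability density
supported between [l] and [r], which localises a function at an end point. *)
Lemma integral_dstep a b : a <= l -> r <= b ->
  (\int[mu]_(x in `]a, b[) (dstep x)%:E = 1)%E.
Proof.
move=> al rb; have ab : a < b by rewrite (le_lt_trans al)// (lt_le_trans lr).
have mE A : measurable_fun A (EFin \o dstep).
  by apply/measurable_EFinP; exact: measurable_dstep.
rewrite integral_itv_bndo_bndc//= integral_itv_obnd_cbnd//=.
rewrite (@continuous_FTC2 _ _ step)//.
- by rewrite step_ge// step_le// sube0.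
- exact/continuous_subspaceT/continuous_dstep.
- split.
  + by move=> x _; have [] := derivable_upto_step 1.
  + exact/cvg_at_right_filter/continuous_step.
  + exact/cvg_at_left_filter/continuous_step.
- by move=> x _; rewrite derive1_step.
Qed.

Lemma integrable_dstep a b : a <= l -> r <= b ->
  mu.-integrable `]a, b[ (EFin \o dstep).
Proof.
move=> al rb; apply/integrableP; split.
  by apply/measurable_EFinP; exact: measurable_dstep.
under eq_integral do rewrite /= ger0_norm ?dstep_ge0//.
by rewrite integral_dstep// ltry.
Qed.

End Step.

(** * Testing a weak derivative against smooth plateaux *)

Lemma integrable_dominated d (T : measurableType d) (R : realType)
    (mu : {measure set T -> \bar R}) (D : set T) (h g : T -> R) :
  measurable D -> measurable_fun D h ->
  mu.-integrable D (EFin \o g) -> (forall x, D x -> `|h x| <= g x) ->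
  mu.-integrable D (EFin \o h) /\
  `|\int[mu]_(x in D) h x| <= \int[mu]_(x in D) g x.
Proof.
move=> mD mh ig hg.
have ih : mu.-integrable D (EFin \o h).
  apply: le_integrable ig => //; first exact/measurable_EFinP.
  by move=> x Dx /=; rewrite lee_fin (le_trans (hg x Dx))// ler_norm.
split=> //; apply: (le_trans (le_normr_Rintegral mD ih)).
apply: le_Rintegral => //.
by rewrite (_ : _ \o _ = abse \o (EFin \o h))//; exact: integrable_abse.
Qed.

(** The bound on [a - c] is needed only where the density lives; this turns
closeness to a one-sided limit into an estimate of an integral over all of [D]. *)
Lemma weighted_mean_error d (T : measurableType d) (R : realType)
    (mu : {measure set T -> \bar R}) (D : set T) (a rho : T -> R) (c e : R) :
  measurable D -> measurable_fun D a ->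
  mu.-integrable D (EFin \o rho) -> (forall x, 0 <= rho x) ->
  \int[mu]_(x in D) rho x = 1 ->
  (forall x, D x -> rho x != 0 -> `|a x - c| <= e) ->
  mu.-integrable D (EFin \o (fun x => (a x - c) * rho x)) /\
  `|\int[mu]_(x in D) ((a x - c) * rho x)| <= e.
Proof.
move=> mD ma irho rho0 int_rho ac_le.
have mrho : measurable_fun D rho by apply/measurable_EFinP; exact: measurable_int irho.
have -> : e = \int[mu]_(x in D) (e * rho x) by rewrite RintegralZl// int_rho mulr1.
apply: integrable_dominated => //.
- by apply: measurable_funM => //; exact: measurable_funB.
- exact: (integrableZl mD e irho).
- move=> x Dx; rewrite normrM (ger0_norm (rho0 x)).
  have [->|rhox] := eqVneq (rho x) 0; first by rewrite !mulr0.
  exact: ler_wpM2r (rho0 x) _ _ (ac_le x Dx rhox).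
Qed.

Section WeakDerivative.
Context (R : realType) (t : R) (t0 : 0 < t).
Local Notation mu := (@lebesgue_measure R).
Local Notation D := `]0, t[%classic.

Let mD : measurable (D : set (measurableTypeR R)).
Proof. exact: measurable_itv. Qed.

Let muD : (mu D < +oo)%E.
Proof. by rewrite lebesgue_measure_itv/= lte_fin t0 ltry. Qed.

Lemma integrable_cst (c : R) : mu.-integrable D (EFin \o cst c).
Proof.
apply: (measurable_bounded_integrable mD muD); first exact: measurable_cst.
by exists `|c|; split; rewrite ?num_real// => y cy x _ /=; exact: ltW.
Qed.

(** Test against phi = step(eta, 2 eta) - step(t - 2 eta, t - eta), a smooth
plateau equal to 1 away from the end points. Then
[\int b = - \int a phi' + \int b (1 - phi)], where phi' = rho1 - rho2 is a
difference of probability densities concentrated near 0 and near t. The first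
term is within [2 e] of [beta - alpha], and the second is at most [4 eta M]
since [1 - phi] lives on two intervals of length [2 eta]. *)
Lemma integral_weak_derivative_bounded (a b : R -> R) (M alpha beta : R) :
  measurable_fun D a -> measurable_fun D b -> (forall x, `|b x| <= M) ->
  a s @[s --> 0^'+] --> alpha -> a s @[s --> t^'-] --> beta ->
  (forall phi, test_function t phi ->
    \int[mu]_(s in D) (a s * (phi^`())%classic s) =
    - \int[mu]_(s in D) (b s * phi s)) ->
  \int[mu]_(s in D) b s = beta - alpha.
Proof.
move=> ma mb bM a_alpha a_beta weak.
have M0 : 0 <= M := le_trans (normr_ge0 _) (bM 0).
have [|ib _] := integrable_dominated mD mb (integrable_cst M) => [x _|].
  exact: bM.
suff small (e : R) : 0 < e ->
    `|\int[mu]_(s in D) b s - (beta - alpha)| <= (4 * M + 2) * e.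
  apply/eqP; rewrite -subr_eq0 -normr_le0; apply/ler_addgt0Pr => e e0.
  rewrite add0r; have M2 : 0 < 4 * M + 2 by lra.
  by have := small _ (divr_gt0 e0 M2); rewrite [leRHS]mulrC divfK ?gt_eqF.
move=> e0.
have [d1 /= d10 near_alpha] : exists2 d1 : R, 0 < d1 &
    forall s, 0 < s < d1 -> `|a s - alpha| <= e.
  have /cvgrPdist_le/(_ _ e0)[d1 /= d10 P] := a_alpha.
  exists d1 => // s /andP[s0 sd]; rewrite distrC; apply: P => //=.
  by rewrite sub0r normrN gtr0_norm.
have [d2 /= d20 near_beta] : exists2 d2 : R, 0 < d2 &
    forall s, t - d2 < s < t -> `|a s - beta| <= e.
  have /cvgrPdist_le/(_ _ e0)[d2 /= d20 P] := a_beta.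
  exists d2 => // s /andP[sd st]; rewrite distrC; apply: P => //=.
  by rewrite gtr0_norm ?subr_gt0// ltrBlDr -ltrBlDl.
(* eta <= d / 3 makes 2 eta < d, and eta <= t / 5 keeps the two transitions
   of the plateau apart. *)
pose eta := Num.min (Num.min (d1 / 3) (d2 / 3)) (Num.min e (t / 5)).
have eta0 : 0 < eta by rewrite !lt_min e0 !divr_gt0.
have [[eta_d1 eta_d2] [eta_e eta_t]] :
    (eta <= d1 / 3 /\ eta <= d2 / 3) /\ (eta <= e /\ eta <= t / 5).
  by rewrite !ge_min !lexx !orbT.
clearbody eta.
have a_near_0 s : 0 < s -> s <= 2 * eta -> `|a s - alpha| <= e.
  by move=> s0 s_le; apply: near_alpha; rewrite s0/=; lra.
have a_near_t s : t - 2 * eta <= s -> s < t -> `|a s - beta| <= e.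
  by move=> s_ge st; apply: near_beta; rewrite st andbT; lra.
have [l1 r1] : 0 <= eta /\ 2 * eta <= t by split; lra.
have [l2 r2] : 0 <= t - 2 * eta /\ t - eta <= t by split; lra.
have [eta2 t_eta2] : 0 <= 2 * eta /\ t - 2 * eta <= t by split; lra.
have r1_le_l2 : 2 * eta <= t - 2 * eta by lra.
have final (x y z : R) : x <= M * (4 * eta) -> y <= e -> z <= e ->
    x + y + z <= (4 * M + 2) * e.
  have : M * eta <= M * e by rewrite ler_wpM2l.
  lra.
have lr1 : eta < 2 * eta by lra.
have lr2 : t - 2 * eta < t - eta by lra.
pose phi : R -> R := step eta (2 * eta) + cst (-1) * step (t - 2 * eta) (t - eta).
have dphi : (phi^`())%classic =
    fun s => dstep eta (2 * eta) s - dstep (t - 2 * eta) (t - eta) s.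
  have dphi s := is_deriveD (is_derive_step lr1 s)
    (is_deriveM (is_derive_cst (-1 : R) s 1) (is_derive_step lr2 s)).
  apply/funext => s; rewrite derive1E (derive_val (is_derive := dphi s)).
  by rewrite /GRing.scale/= mulr0 addr0 mulN1r.
have phi_test : test_function t phi.
  split=> [n x|].
    apply: derivable_upto_derive; apply: derivable_uptoD.
      exact: derivable_upto_step.
    by apply: derivable_uptoM; [exact: derivable_upto_cst|exact: derivable_upto_step].
  exists `[eta, t - eta]%classic.
    split; first exact: segment_compact.
    by move=> x /=; rewrite !in_itv/= => /andP[? ?]; apply/andP; split; lra.
  move=> x; rewrite /= in_itv/= => /negP; rewrite negb_and -!ltNge => /orP[xl|xr].
    by rewrite /phi !fctE !step_le ?mulr0 ?addr0//; lra.
  by rewrite /phi !fctE !step_ge ?mulr1 ?subrr//; lra.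
have := weak _ phi_test; rewrite dphi.
set rho1 := dstep eta _; set rho2 := dstep (t - _) _ => weak_phi.
have [mrho1 mrho2] : measurable_fun D rho1 /\ measurable_fun D rho2.
  by split; exact: measurable_dstep.
have [irho1 int_rho1] : mu.-integrable D (EFin \o rho1) /\ \int[mu]_(s in D) rho1 s = 1.
  by split; [exact: integrable_dstep|rewrite /Rintegral integral_dstep].
have [irho2 int_rho2] : mu.-integrable D (EFin \o rho2) /\ \int[mu]_(s in D) rho2 s = 1.
  by split; [exact: integrable_dstep|rewrite /Rintegral integral_dstep].
have int_scale c rho : mu.-integrable D (EFin \o rho) ->
    \int[mu]_(s in D) rho s = 1 ->
    mu.-integrable D (EFin \o (fun s => c * rho s)) /\
    \int[mu]_(s in D) (c * rho s) = c.
  by move=> irho rho1E; split; [exact: (integrableZl mD c irho)|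
    rewrite RintegralZl// rho1E mulr1].
have [iarho1 int_arho1] := int_scale alpha _ irho1 int_rho1.
have [ibrho2 int_brho2] := int_scale beta _ irho2 int_rho2.
have [ih1 h1_le] : mu.-integrable D (EFin \o (fun s => (a s - alpha) * rho1 s)) /\
    `|\int[mu]_(s in D) ((a s - alpha) * rho1 s)| <= e.
  apply: weighted_mean_error => // [s|s]; first exact: dstep_ge0.
  rewrite /= in_itv/= => /andP[s0 st] rho_neq0; apply: a_near_0 => //.
  apply: contraNT rho_neq0; rewrite -ltNge => s_gt.
  by rewrite /rho1 dstep_out//; right; exact: ltW.
have [ih2 h2_le] : mu.-integrable D (EFin \o (fun s => (a s - beta) * rho2 s)) /\
    `|\int[mu]_(s in D) ((a s - beta) * rho2 s)| <= e.
  apply: weighted_mean_error => // [s|s]; first exact: dstep_ge0.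
  rewrite /= in_itv/= => /andP[s0 st] rho_neq0; apply: a_near_t => //.
  apply: contraNT rho_neq0; rewrite -ltNge => s_lt.
  by rewrite /rho2 dstep_out//; left; exact: ltW.
have mphi : measurable_fun D phi.
  by apply: measurable_funD; [|apply: measurable_funM => //]; exact: measurable_step.
have phiE s : phi s = step eta (2 * eta) s - step (t - 2 * eta) (t - eta) s.
  by rewrite /phi !fctE mulN1r.
have phi_bound s : 0 <= phi s <= 1.
  rewrite phiE; have [s_le|s_gt] := leP s (t - 2 * eta).
    by rewrite (step_le _ s_le) subr0 step_ge0// step_le1.
  rewrite (step_ge lr1 (ltW (le_lt_trans r1_le_l2 s_gt))).
  by rewrite subr_ge0 step_le1//= lerBlDr lerDl step_ge0.
pose ends s : R := \1_`[0, 2 * eta] s + \1_`[t - 2 * eta, t] s.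
have [iends int_ends] : mu.-integrable D (EFin \o (fun s => M * ends s)) /\
    \int[mu]_(s in D) (M * ends s) <= M * (4 * eta).
  have iI l r : mu.-integrable D (EFin \o \1_`[l, r]).
    exact: integrableS measurableT mD (@subsetT _ _)
      (integrable_indic_itv l r true false).
  have int_I l r : l <= r -> \int[mu]_(s in D) \1_`[l, r] s <= r - l.
    move=> lr; rewrite /Rintegral integral_indic//= -[leRHS]/(fine (r - l)%:E).
    have mu_lr : mu `[l, r] = (r - l)%:E.
      rewrite lebesgue_measure_itv/= lte_fin; case: ltgtP lr => // -> _.
      by rewrite subrr.
    rewrite -mu_lr fine_le//; last 1 first.
    + by rewrite le_measure// inE//; exact: measurableI.
    + rewrite ge0_fin_numE//; apply: le_lt_trans muD.
      by rewrite le_measure// inE//; exact: measurableI.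
    + by rewrite mu_lr.
  have iends : mu.-integrable D (EFin \o ends).
    exact: (integrableD mD (iI 0 (2 * eta)) (iI (t - 2 * eta) t)).
  split; first exact: (integrableZl mD M iends).
  rewrite RintegralZl// ler_wpM2l// RintegralD//.
  apply: le_trans (lerD (int_I _ _ eta2) (int_I _ _ t_eta2)) _.
  by rewrite subr0 subKr -mulrDl -natrD.
have [ibphi _] : mu.-integrable D (EFin \o (fun s => b s * phi s)) /\
    `|\int[mu]_(s in D) (b s * phi s)| <= \int[mu]_(s in D) (cst M s).
  apply: integrable_dominated => //; [exact: measurable_funM|exact: integrable_cst|].
  move=> s _; have /andP[p0 p1] := phi_bound s.
  by rewrite normrM (ger0_norm p0) (le_trans _ (bM s))// ler_piMr.
have [ih3 h3_le] : mu.-integrable D (EFin \o (fun s => b s * (1 - phi s))) /\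
    `|\int[mu]_(s in D) (b s * (1 - phi s))| <= \int[mu]_(s in D) (M * ends s).
  apply: integrable_dominated => //.
    by apply: measurable_funM => //; apply: measurable_funB.
  move=> s; rewrite /= in_itv/= => /andP[s0 st]; have /andP[p0 p1] := phi_bound s.
  rewrite normrM ler_pM//.
  have indic_ge0 (A : set R) : 0 <= \1_A s :> R by [].
  have [s_le|s_gt] := leP s (2 * eta).
    rewrite /ends [\1_`[0, _] s]indicE mem_set/= ?in_itv/= ?(ltW s0)//.
    by rewrite ger0_norm ?subr_ge0// lerBlDr -addrA lerDl addr_ge0.
  have [s_ge|s_lt] := leP (t - 2 * eta) s.
    rewrite /ends [\1_`[_, t] s]indicE mem_set/= ?in_itv/= ?s_ge ?(ltW st)//.
    by rewrite ger0_norm ?subr_ge0// lerBlDr addrAC lerDr addr_ge0.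
  rewrite phiE (step_ge lr1 (ltW s_gt)) (step_le _ (ltW s_lt)) subr0 subrr normr0.
  by rewrite addr_ge0.
have int_aphi : \int[mu]_(s in D) (a s * (rho1 s - rho2 s)) =
    \int[mu]_(s in D) ((a s - alpha) * rho1 s) + alpha -
    (\int[mu]_(s in D) ((a s - beta) * rho2 s) + beta).
  transitivity (\int[mu]_(s in D) (((a s - alpha) * rho1 s + alpha * rho1 s) -
      ((a s - beta) * rho2 s + beta * rho2 s))).
    by apply: eq_Rintegral => s _; ring.
  rewrite RintegralB//; first by rewrite !RintegralD// int_arho1 int_brho2.
  - exact: (integrableD mD ih1 iarho1).
  - exact: (integrableD mD ih2 ibrho2).
have int_b : \int[mu]_(s in D) b s =
    \int[mu]_(s in D) (b s * phi s) + \int[mu]_(s in D) (b s * (1 - phi s)).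
  by rewrite -RintegralD//; apply: eq_Rintegral => s _; ring.
have int_bphi : \int[mu]_(s in D) (b s * phi s) =
    - \int[mu]_(s in D) (a s * (rho1 s - rho2 s)) by rewrite weak_phi opprK.
rewrite int_b int_bphi int_aphi.
set I1 := \int[mu]_(s in D) ((a s - alpha) * rho1 s) in h1_le *.
set I2 := \int[mu]_(s in D) ((a s - beta) * rho2 s) in h2_le *.
set I3 := \int[mu]_(s in D) (b s * (1 - phi s)) in h3_le *.
(* The constants alpha and beta cancel, and only the three error terms stay. *)
rewrite (_ : _ - _ = I3 - I1 + I2); last by ring.
apply: le_trans (ler_normD _ _) (le_trans (lerD (ler_normB _ _) (lexx _)) _).
exact: final (le_trans h3_le int_ends) h1_le h2_le.
Qed.

End WeakDerivative.

(** * Sobolev functions on an interval *)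

#[local] Instance ae_lebesgue_filter (R : realType) :
  Filter (almost_everywhere (@lebesgue_measure R)).
Proof. exact: ae_filter_ringOfSetsType. Qed.

Section Sobolev.
Context (R : realType) (t : R).
Local Notation mu := (@lebesgue_measure R).
Local Notation D := `]0, t[%classic.

Let mD : measurable (D : set (measurableTypeR R)).
Proof. exact: measurable_itv. Qed.

(** Truncation at the essential bound, so that later estimates hold at every point. *)
Lemma Linfty_bounded_version (f : R -> R) : Linfty t f ->
  exists2 b : R -> R, measurable_fun D b &
    {ae mu, forall s, D s -> f s = b s} /\ exists M, forall s, `|b s| <= M.
Proof.
move=> [mf [M fM]]; pose K := Num.max M 0.
have K0 : 0 <= K by rewrite le_max lexx orbT.
exists (fun s => Num.max (- K) (Num.min K (f s))).
  apply: measurable_maxr => //; exact: measurable_minr.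
split; last first.
  exists K => s; rewrite ler_norml le_max lexx/= ge_max ge_min lexx/= andbT.
  by rewrite (le_trans _ K0)// oppr_le0.
apply: filterS fM => s fM /fM fsM.
have : `|f s| <= K by rewrite (le_trans fsM)// le_max lexx.
by rewrite ler_norml => /andP[? ?]; rewrite min_r// max_r.
Qed.

Lemma Linfty_integrable (f : R -> R) : 0 < t -> Linfty t f ->
  mu.-integrable D (EFin \o f).
Proof.
move=> t0 Lf; have [b mb [fb [M bM]]] := Linfty_bounded_version Lf.
have [mf _] := Lf.
have [|/integrableP[_ ib] _] := integrable_dominated mD mb (integrable_cst t0 M).
  by move=> s _; exact: bM.
apply/integrableP; split; first exact/measurable_EFinP.
apply: le_lt_trans ib; rewrite le_eqVlt; apply/orP; left; apply/eqP.
apply: ae_eq_integral => //.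
- by apply: measurableT_comp => //; exact/measurable_EFinP.
- by apply: measurableT_comp => //; exact/measurable_EFinP.
- by apply: filterS fb => s fbs Ds /=; rewrite fbs.
Qed.

Lemma ae_eq_Rintegral (f g : R -> R) : measurable_fun D f -> measurable_fun D g ->
  {ae mu, forall s, D s -> f s = g s} ->
  \int[mu]_(s in D) f s = \int[mu]_(s in D) g s.
Proof.
move=> mf mg fg; rewrite /Rintegral; congr fine; apply: ae_eq_integral => //.
- exact/measurable_EFinP.
- exact/measurable_EFinP.
- by apply: filterS fg => s fgs Ds; rewrite fgs.
Qed.

(** The fundamental theorem of calculus for Sobolev functions. Both sides of the
defining identity of a weak derivative are unchanged when [a] is replaced by its
continuous representative and [a'] by a bounded version. *)
Theorem integral_weak_derivative (a a' : R -> R) (alpha beta : R) : 0 < t ->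
  W1infty t a a' -> boundary_values t a alpha beta ->
  \int[mu]_(s in D) a' s = beta - alpha.
Proof.
move=> t0 [[ma _] La' weak] [ac [ac_cont a_ac ac0 act]].
have [b mb [a'b [M bM]]] := Linfty_bounded_version La'.
have [ma' _] := La'.
have mac : measurable_fun D ac.
  apply: open_continuous_measurable_fun; first exact: interval_open.
  by move=> s; rewrite inE => sD; exact: ac_cont.
rewrite (ae_eq_Rintegral ma' mb a'b).
apply: (integral_weak_derivative_bounded t0 mac mb bM ac0 act) => phi phi_test.
have [dphi _] := phi_test.
have mphi : measurable_fun D phi.
  apply: measurable_funTS; apply: continuous_measurable_fun => x.
  by apply: differentiable_continuous; apply/derivable1_diffP; exact: (dphi 0%N).
have mdphi : measurable_fun D (phi^`())%classic.
  apply: measurable_funTS; apply: continuous_measurable_fun => x.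
  by apply: differentiable_continuous; apply/derivable1_diffP; exact: (dphi 1%N).
rewrite -(@ae_eq_Rintegral (fun s => a s * (phi^`())%classic s)).
- rewrite weak//; congr (- _); apply: ae_eq_Rintegral; try exact: measurable_funM.
  by apply: filterS a'b => s a'bs Ds; rewrite a'bs.
- exact: measurable_funM.
- exact: measurable_funM.
- by apply: filterS a_ac => s a_acs Ds; rewrite a_acs.
Qed.

End Sobolev.

(** * Steering along a' B^dagger S xi *)

Theorem proposition5p1 (R : realType)
    (E : completeNormedModType R)
    (H : completeNormedModType R) (dot : {dot H for (@idfun R)})
    (S : R -> {linear E -> E}) (B : {linear H -> E})
    (d : measure_display) (Omega : measurableType d) (P : probability Omega R)
    (W : R -> H -> {RV P >-> R})
    (t : R) (a a' : R -> R) (xi : E) :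
  inner_product_norm dot -> separable_space H ->
  C0_semigroup S -> continuous B ->
  cylindrical_brownian_motion dot W ->
  (forall T : R, 0 < T ->
     stochastically_integrable_on dot T (fun s h => S s (B h))) ->
  0 < t ->
  W1infty t a a' -> boundary_values t a 0 1 ->
  admissible dot B S t xi ->
  bochner_integrable (@lebesgue_measure R) `]0, t[
    (R_integrand B S t (v_ctrl dot B S a' xi)) /\
  R_op B S t (v_ctrl dot B S a' xi) = S t xi.
Proof.
move=> dot_norm _ [_ _ S_add _] cB _ _ t0 a_W1 a_bv [xi_adm _].
have mD : measurable (`]0, t[%classic : set (measurableTypeR R)).
  exact: measurable_itv.
have muD : (@lebesgue_measure R `]0%R, t[ < +oo)%E.
  by rewrite lebesgue_measure_itv/= lte_fin t0 ltry.
have ia' : (@lebesgue_measure R).-integrable `]0, t[ (EFin \o a').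
  by have [_ La' _] := a_W1; exact: Linfty_integrable.
have integrandE : {ae @lebesgue_measure R, forall s, `]0, t[%classic s ->
    R_integrand B S t (v_ctrl dot B S a' xi) s = a' s *: S t xi}.
  (* Where S s xi lies in the range of B, the control undoes B, and the semigroup
     law S (t - s) (S s xi) = S t xi removes the dependence on s. *)
  apply: filterS xi_adm => s s_adm s_in.
  have /andP[s0 st] : 0 < s < t by move: s_in; rewrite /= in_itv.
  rewrite /R_integrand /v_ctrl !linearZ/= (Bdag_range dot_norm cB (s_adm s_in)).
  by rewrite -S_add ?subr_ge0 ?ltW// subrK.
have [int_integrand integralE] := bochner_integral_scale mD muD ia' integrandE.
split=> //; apply: (etrans integralE).
by rewrite (integral_weak_derivative t0 a_W1 a_bv) subr0 scale1r.
Qed.
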